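(* Let $R$ be an associative ring with identity, $M$ a right $R$-module, and let $m_1,m_2\in M$ with $m_1$ and $m_2$ regular. Then the following statements are equivalent: (i) $m_1\leq^{-}m_2$; (ii) $m_1\leq^{\oplus}m_2$.
   Context: Rings are associative with identity, and modules are unitary right modules. For a right $R$-module $M$, let $S=\mathrm{End}_R(M)$ and $M^*=\mathrm{Hom}_R(M,R)$. For $m\in M$ and $\varphi\in M^*$, write $\varphi m:=\varphi(m)\in R$, and let $m\varphi\in S$ denote the endomorphism $x\mapsto m\,\varphi(x)$ of $M$. An element $m\in M$ is (Zelmanowitz) regular if $m=m\varphi m$, i.e. $m=m\,\varphi(m)$, for some $\varphi\in M^*$. Minus order: for $m_1,m_2\in M$, $m_1\leq^{-}m_2$ means that there exists $\varphi\in M^*$ such that $m_1=m_1\varphi m_1$, $m_1\varphi=m_2\varphi$ (in $S$), and $\varphi m_1=\varphi m_2$ (in $R$). Relation $\leq^{\oplus}$: for $m_1,m_2\in M$, $m_1\leq^{\oplus}m_2$ means $m_2R=m_1R\oplus(m_2-m_1)R$ (internal direct sum of submodules of $M$). *)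

(* Defs.v *)
From HB Require Import structures.
From mathcomp Require Import all_boot all_algebra.
From mathcomp Require Import boolp classical_sets.

Set Implicit Arguments.
Unset Strict Implicit.
Unset Printing Implicit Defensive.

Import GRing.Theory.

Local Open Scope classical_set_scope.
Local Open Scope ring_scope.

(* A right R-module is a left module over the converse ring R^c: the scalar
   action r *: m is the right action m r. [pzRingType] is an arbitrary
   associative ring with identity (the zero ring is not excluded). *)

Section RightModule.
Variables (R : pzRingType) (M : lmodType R^c).

Definition rscale (m : M) (r : R) : M := (r : R^c) *: m.

Lemma rscaleM m (r s : R) : rscale (rscale m r) s = rscale m (r * s).
Proof. by rewrite /rscale scalerA. Qed.

(* {scalar M} consists of the linear maps from M to the ring of scalars R^c;
   since the product of R^c is the reversed product of R, these are the maps
   of Hom_R(M, R), R being a right module over itself. *)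
Lemma scalar_rscale (phi : {scalar M}) m (r : R) :
  phi (rscale m r) = (phi m : R) * r.
Proof. exact: linearZ_LR. Qed.

(* The endomorphism m phi : x |-> m (phi x). *)
Definition outer (m : M) (phi : {scalar M}) (x : M) : M := rscale m (phi x).

Fact outer_is_linear m phi : linear (outer m phi).
Proof. by move=> a x y; rewrite /outer /rscale linearP scalerDl -scalerA. Qed.

HB.instance Definition _ m phi :=
  GRing.isLinear.Build R^c M M *:%R (outer m phi) (outer_is_linear m phi).

Definition zregular (m : M) : Prop :=
  exists phi : {scalar M}, m = rscale m (phi m).

(* Elements of End_R(M) are compared as functions. *)
Definition minus_le (m1 m2 : M) : Prop :=
  exists phi : {scalar M},
    [/\ m1 = rscale m1 (phi m1),
        outer m1 phi =1 outer m2 phi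
      & phi m1 = phi m2].

Definition cyclic_submod (m : M) : set M := range (rscale m).

(* C is the internal direct sum of its submodules A and B. *)
Definition internal_direct_sum (C A B : set M) : Prop :=
  C = [set x + y | x in A & y in B] /\ A `&` B = [set 0].

Definition oplus_le (m1 m2 : M) : Prop :=
  internal_direct_sum (cyclic_submod m2)
    (cyclic_submod m1) (cyclic_submod (m2 - m1)).

End RightModule.

(* Main.v *)
(** For the converse implication write [m2 = m2 psi(m2)].  Then [m2 psi] is the
    identity on [m2 R], so [m1 (1 - psi m1) = (m2 - m1) (psi m1)] and
    [m1 (1 - psi m2) = - (m2 - m1) (1 - psi m2)]; both vanish because the sum is
    direct, and [phi x = psi (m1 (psi x))] is the required functional. *)
Require Import Defs.
From mathcomp Require Import all_boot all_algebra.
From mathcomp Require Import classical_sets.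

Import GRing.Theory.
Local Open Scope ring_scope.

Section RightScaling.
Variables (R : pzRingType) (M : lmodType R^c).
Implicit Types (m n : M) (r s : R).

Lemma rscale1 m : rscale m 1 = m.
Proof. exact: scale1r. Qed.

Lemma rscaleBl m n r : rscale (m - n) r = rscale m r - rscale n r.
Proof. exact: scalerBr. Qed.

Lemma rscaleDr m r s : rscale m (r + s) = rscale m r + rscale m s.
Proof. exact: scalerDl. Qed.

Lemma rscaleBr m r s : rscale m (r - s) = rscale m r - rscale m s.
Proof. exact: scalerBl. Qed.

Lemma oplus_le_cyclic m1 m2 : oplus_le m1 m2 -> exists r, m1 = rscale m2 r.
Proof.
case=> sumE _; suff [r _ <-] : cyclic_submod m2 m1 by exists r.
rewrite sumE; exists m1; first by exists 1; rewrite ?rscale1.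
by exists 0; [exists 0; rewrite // /rscale scale0r | rewrite addr0].
Qed.

Lemma oplus_le_disjoint m1 m2 r s :
  oplus_le m1 m2 -> rscale m1 r = rscale (m2 - m1) s -> rscale m1 r = 0.
Proof.
case=> _ capE eq_rs.
suff : (cyclic_submod m1 `&` cyclic_submod (m2 - m1))%classic (rscale m1 r).
  by rewrite capE.
by split; [exists r | rewrite eq_rs; exists s].
Qed.

(** Evaluating [m1 phi = m2 phi] at [m1] puts [m1] in [m2 R]. The sum is direct because [m1 phi]
    fixes [m1 R] pointwise, while [phi m1 = phi m2] makes it vanish on [(m2 - m1) R]. *)
Lemma minus_le_oplus_le m1 m2 : minus_le m1 m2 -> oplus_le m1 m2.
Proof.
case=> phi [m1E outerE phiE].
have m1_m2 : m1 = rscale m2 (phi m1) by rewrite [LHS]m1E; apply: outerE.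
split; apply/seteqP; split=> x.
- case=> r _ <-; exists (rscale m1 r); first by exists r.
  exists (rscale (m2 - m1) r); first by exists r.
  by rewrite rscaleBl addrC subrK.
- case=> _ [r _ <-] [_ [s _ <-] <-].
  (* With [e = phi m1], [m2 e = m1] and [m2 (1 - e) = m2 - m1], so the coefficient is
     [e r + (1 - e) s]. *)
  exists ((phi m1 : R) * r + (s - (phi m1 : R) * s)) => //.
  by rewrite rscaleDr rscaleBr -!rscaleM -m1_m2 rscaleBl.
- case=> [[r _ <-] [s _ eq_rs]] /=.
  rewrite [in LHS]m1E rscaleM -scalar_rscale -eq_rs scalar_rscale.
  rewrite raddfB /= phiE subrr.
  by rewrite mul0r /rscale scale0r.
- by move=> ->; split; exists 0; rewrite // /rscale scale0r.
Qed.

Lemma oplus_le_minus_le m1 m2 :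
  zregular m2 -> oplus_le m1 m2 -> minus_le m1 m2.
Proof.
case=> psi m2E le12; have [a m1a] := oplus_le_cyclic _ _ le12.
have m2psi1 : rscale m2 (psi m1) = m1.
  (* Here [psi m1 = (psi m2) a], and [m2 (psi m2) a] collapses to [m2 a]. *)
  by rewrite m1a scalar_rscale -rscaleM -m2E.
have m1psi1 : rscale m1 (psi m1) = m1.
  apply/esym/eqP; rewrite -subr_eq0 -[X in X - _]rscale1 -rscaleBr; apply/eqP.
  apply: (oplus_le_disjoint _ m2 _ (psi m1)) => //.
  by rewrite rscaleBr rscaleBl rscale1 m2psi1.
have m1psi2 : rscale m1 (psi m2) = m1.
  apply/esym/eqP; rewrite -subr_eq0 -[X in X - _]rscale1 -rscaleBr; apply/eqP.
  apply: (oplus_le_disjoint _ m2 _ ((psi m2 : R) - 1)) => //.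
  by rewrite rscaleBl !rscaleBr !rscale1 -m2E subrr sub0r opprB.
(* [psi] alone need not take equal values at [m1] and [m2]. Composing with [m1 psi], which sends
   both to [m1], makes both values [psi m1]; the endomorphisms [m1 phi] and [m2 phi] then both
   reduce to [m1 psi]. *)
exists (psi \o outer m1 psi : {scalar M}).
split=> [|x|]; rewrite /outer /= ?/outer.
- by rewrite !m1psi1.
- by rewrite scalar_rscale -!rscaleM m1psi1 m2psi1.
- by rewrite m1psi1 m1psi2.
Qed.

End RightScaling.

Theorem theorem3p14 (R : pzRingType) (M : lmodType R^c) (m1 m2 : M)
  (hm1 : zregular m1) (hm2 : zregular m2) :
  minus_le m1 m2 <-> oplus_le m1 m2.
Proof. by split; [apply: minus_le_oplus_le | apply: oplus_le_minus_le]. Qed.
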